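(* The group $\mathrm{Homeo}^+([0,1])$ can be partitioned into a Haar null set and a meagre set.
   Context: $\mathrm{Homeo}^+([0,1])$ is the Polish group (under composition) of increasing homeomorphisms of $[0,1]$ with the topology of uniform convergence. Haar null sets (Christensen): in a Polish group $G$, a Borel set $B\subset G$ is Haar null if there is a Borel probability measure $\mu$ on $G$ such that $\mu(gBh)=0$ for all $g,h\in G$; an arbitrary set $S \subset G$ is Haar null if it is contained in a Borel Haar null set. *)

(* Defs.v *)
From HB Require Import structures.
From mathcomp Require Import all_boot all_order all_algebra.
From mathcomp Require Import all_classical all_reals all_analysis.

Set Implicit Arguments.
Unset Strict Implicit.
Unset Printing Implicit Defensive.

Import Order.TTheory GRing.Theory Num.Theory.
Import numFieldNormedType.Exports.

Local Open Scope classical_set_scope.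
Local Open Scope ring_scope.

HB.mixin Record isTopologicalGroup G & Group G & Topological G := {
  mulg_continuous : continuous (fun p : G * G => (p.1 * p.2)%g);
  invg_continuous : continuous (fun x : G => (x^-1)%g)
}.

(* The library's generated sigma-algebras live on pointed types, hence the
   [Pointed] component. *)
#[short(type="topGroupType")]
HB.structure Definition TopGroup :=
  {G of isTopologicalGroup G & Group G & Pointed G & Topological G}.

Definition borel_type (G : ptopologicalType) :=
  g_sigma_algebraType (@open G).

Definition borel_haar_null (R : realType) (G : topGroupType) (B : set G) :=
  (@open G).-sigma.-measurable B /\
  exists mu : probability (borel_type G) R,
    forall g h : G, mu [set (g * x * h)%g | x in B] = 0%E.

Definition haar_null (R : realType) (G : topGroupType) (S : set G) :=
  exists2 B : set G, borel_haar_null R B & S `<=` B.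

Definition nowhere_dense (T : topologicalType) (A : set T) :=
  interior (closure A) = set0.

Definition meagre (T : topologicalType) (A : set T) :=
  exists2 F : nat -> set T,
    (forall n, nowhere_dense (F n)) & A = \bigcup_n F n.

Definition unit_itv (R : realType) : Type := `[0%R : R, 1%R]%classic.

HB.instance Definition _ (R : realType) :=
  PseudoMetric.copy (unit_itv R) (set_type (`[0%R : R, 1%R]%classic)).

Definition is_increasing_homeo (R : realType) : set (unit_itv R -> unit_itv R) :=
  [set f | [/\ forall x y, set_val x < set_val y -> set_val (f x) < set_val (f y),
     continuous f &
     exists g, [/\ cancel f g, cancel g f & continuous g]]].

(* As a [set_type], it carries the subspace topology of the space of functions
   with the topology of uniform convergence. *)
Definition homeo (R : realType) : Type :=
  (@is_increasing_homeo R : set {uniform unit_itv R -> unit_itv R}).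

HB.instance Definition _ (R : realType) := Uniform.copy (homeo R)
  (set_type (@is_increasing_homeo R : set {uniform unit_itv R -> unit_itv R})).

Section homeo_group.
Variable R : realType.
Local Notation I := (unit_itv R).
Implicit Types f g h : homeo R.

Definition homeo_fun f : I -> I := set_val f.

Lemma homeo_funP f : is_increasing_homeo (homeo_fun f).
Proof. exact: set_valP. Qed.

Definition mk_homeo (f : I -> I) (Hf : is_increasing_homeo f) : homeo R :=
  exist _ (f : {uniform I -> I}) (mem_set Hf).

Lemma homeo_eq f g : homeo_fun f =1 homeo_fun g -> f = g.
Proof. by move=> fg; apply: val_inj; exact/funext. Qed.

Lemma is_increasing_homeo_id : is_increasing_homeo (@id I).
Proof. by split=> // [x|]; [exact: cvg_id|exists id; split=> // x; exact: cvg_id]. Qed.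

Definition homeo_one := mk_homeo is_increasing_homeo_id.

Lemma is_increasing_homeo_comp (f g : I -> I) :
  is_increasing_homeo f -> is_increasing_homeo g ->
  is_increasing_homeo (f \o g).
Proof.
move=> [fi fc [f' [ff' f'f f'c]]] [gi gc [g' [gg' g'g g'c]]]; split.
- by move=> x y xy; exact/fi/gi.
- by move=> x; apply: continuous_comp; [exact: gc|exact: fc].
- exists (g' \o f'); split; [exact: can_comp|exact: can_comp|].
  by move=> x; apply: continuous_comp; [exact: f'c|exact: g'c].
Qed.

Definition homeo_mul f g :=
  mk_homeo (is_increasing_homeo_comp (homeo_funP f) (homeo_funP g)).

Lemma increasing_homeo_inv f : exists g : I -> I,
  [/\ cancel (homeo_fun f) g, cancel g (homeo_fun f) &
      is_increasing_homeo g].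
Proof.
have [fi fc [g [fg gf gc]]] := homeo_funP f.
exists g; split=> //; split=> //; last by exists (homeo_fun f).
move=> x y xy; rewrite ltNge; apply/negP; rewrite le_eqVlt => /predU1P[e|/fi].
  by move: xy; rewrite -(gf x) -(gf y) (val_inj e) ltxx.
by rewrite !gf => /(lt_trans xy); rewrite ltxx.
Qed.

Definition homeo_inv f : homeo R :=
  let: exist _ H := cid (increasing_homeo_inv f) in
  let: And3 _ _ Hg := H in mk_homeo Hg.

Lemma homeo_invK f : cancel (homeo_fun f) (homeo_fun (homeo_inv f)).
Proof. by rewrite /homeo_inv; case: cid => g []. Qed.

Lemma homeo_invVK f : cancel (homeo_fun (homeo_inv f)) (homeo_fun f).
Proof. by rewrite /homeo_inv; case: cid => g []. Qed.

Lemma homeo_mulA : associative homeo_mul.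
Proof. by move=> f g h; exact: homeo_eq. Qed.

Lemma homeo_mul1 : left_id homeo_one homeo_mul.
Proof. by move=> f; exact: homeo_eq. Qed.

Lemma homeo_mulr1 : right_id homeo_one homeo_mul.
Proof. by move=> f; exact: homeo_eq. Qed.

Lemma homeo_mulV : left_inverse homeo_one homeo_inv homeo_mul.
Proof. by move=> f; apply: homeo_eq => x; exact: homeo_invK. Qed.

Lemma homeo_mulrV : right_inverse homeo_one homeo_inv homeo_mul.
Proof. by move=> f; apply: homeo_eq => x; exact: homeo_invVK. Qed.

HB.instance Definition _ := isPointed.Build (homeo R) homeo_one.
HB.instance Definition _ := isGroup.Build (homeo R)
  homeo_mulA homeo_mul1 homeo_mulr1 homeo_mulV homeo_mulrV.

Lemma homeo_nbhsP f (P : set (homeo R)) :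
  nbhs f P <-> exists2 E : set (I * I), entourage E &
    [set g | forall x, E (homeo_fun f x, homeo_fun g x)] `<=` P.
Proof.
split.
  case=> _ /= [[W oW <-] /= Wf WP].
  have /uniform_nbhs[E [entE EW]] : nbhs (set_val f : {uniform I -> I}) W.
    exact: open_nbhs_nbhs.
  by exists E => // g Eg; apply/WP/EW => x _; exact: Eg.
move=> [E entE EP].
have /uniform_nbhs Ef : exists E' : set (I * I), entourage E' /\
    [set h : {uniform I -> I} | forall y, [set: I] y -> E' (set_val f y, h y)]
    `<=` [set h | forall y, E (set_val f y, h y)].
  by exists E; split=> // h Eh y; exact: Eh.
move: Ef; rewrite nbhsE => -[W [oW Wf] WE].
exists (set_val @^-1` W); split=> //; first by exists W.
by move=> g /WE Eg; apply: EP.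
Qed.

Lemma compact_unit_itv : compact [set: I].
Proof.
have cR : compact (`[0%R : R, 1%R]%classic) := @segment_compact R 0 1.
have /compact_near_coveringP nR := cR.
apply/compact_near_coveringP => J F P FF cov.
have nf := nR J F (fun j r => forall x : I, set_val x = r -> P j x) FF.
have : \near F, `[0%R : R, 1%R]%classic `<=`
    (fun r => forall x : I, set_val x = r -> P F x).
  apply: nf => r r01; pose x : I := exist _ r (mem_set r01).
  have [[/= A B] [[_ [[W oW <-] /= Wx] WA] FB] AB] := cov x Logic.I.
  exists (W, B) => /=; first by split=> //; exact: open_nbhs_nbhs.
  move=> [r' j] /= [Wr' Bj] y yr'; apply: (AB (y, j)); split=> //=.
  by apply: WA; rewrite /preimage /= yr'.
by apply: filterS => j sub x _; exact: (sub (set_val x) (set_valP x)).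
Qed.

Lemma continuous_unit_itv_unif (f : I -> I) : continuous f ->
  forall E : set (I * I), entourage E ->
  exists2 U : set (I * I), entourage U &
    forall x y, U (x, y) -> E (f x, f y).
Proof.
move=> fc E entE; have [E' entE' E'E] := entourage_split_ex entE.
have /compact_near_coveringP cI := compact_unit_itv.
have : \forall e \near (0 : R)^'+, [set: I] `<=`
    (fun x => forall y, ball x e y -> E (f x, f y)).
  apply: cI => x _.
  have /nbhs_ballP[d d0 dE] : nbhs x (f @^-1` xsection (E' `&` E'^-1%relation) (f x)).
    apply: fc; apply: nbhs_entourage; apply: filterI => //.
  exists (ball x (d / 2), [set e | e < d / 2]) => /=.
    split; first by apply: nbhsx_ballx; rewrite divr_gt0.
    by apply: nbhs_right_lt; rewrite divr_gt0.
  move=> [x' e] /= [xx' ed] y xy.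
  have /xsectionP[_ /= x'E] : xsection (E' `&` E'^-1%relation) (f x) (f x').
    by apply: dE; apply: le_ball xx'; rewrite ler_pdivrMr// ler_peMr// ?ler1n// ltW.
  have /xsectionP[/= yE _] : xsection (E' `&` E'^-1%relation) (f x) (f y).
    apply: dE; rewrite [d]splitr; apply: (ball_triangle xx').
    by apply: le_ball xy; exact: ltW.
  by apply: E'E; exists (f x).
move=> /filterI /(_ (nbhs_right_gt 0)) /filter_ex[e [He e0]].
exists [set xy | ball xy.1 e xy.2]; last by move=> x y; exact: He.
by rewrite -entourage_ballE; exists e.
Qed.

Lemma homeo_mul_continuous :
  continuous (fun p : homeo R * homeo R => (p.1 * p.2)%g).
Proof.
move=> [f g] P /homeo_nbhsP[E entE EP].
have [E' entE' E'E] := entourage_split_ex entE.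
have [_ fc _] := homeo_funP f.
have [U entU UE'] := continuous_unit_itv_unif fc entE'.
exists ([set h | forall x, E' (homeo_fun f x, homeo_fun h x)],
        [set h | forall x, U (homeo_fun g x, homeo_fun h x)]) => /=.
  by split; apply/homeo_nbhsP; [exists E'|exists U].
move=> [f' g'] /= [ff' gg']; apply: EP => x /=; apply: E'E.
by exists (homeo_fun f (homeo_fun g' x)); [exact: UE'|exact: ff'].
Qed.

Lemma homeo_inv_continuous : continuous (fun f : homeo R => (f^-1)%g).
Proof.
move=> f P /homeo_nbhsP[E entE EP].
have [_ fc _] := homeo_funP (f^-1)%g.
have [U entU UE] := continuous_unit_itv_unif fc (entourage_inv entE).
apply/homeo_nbhsP; exists U => // g fg; apply: EP => y /=.
have := UE _ _ (fg (homeo_fun (g^-1)%g y)).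
by rewrite homeo_invK homeo_invVK.
Qed.

HB.instance Definition _ := isTopologicalGroup.Build (homeo R)
  homeo_mul_continuous homeo_inv_continuous.

End homeo_group.

(* Main.v *)
Require Import Defs.
From mathcomp Require Import all_boot all_order all_algebra.
From mathcomp Require Import all_classical all_reals all_analysis.
From mathcomp Require Import measurable_realfun zify ring lra.

(* Let f_a(x) = x + (a/2) min(x, 1-x) for a uniform in [0,1].  A zigzag set W
   consists of the homeomorphisms f with f(x_i) < s_i < f(y_i) for all i < n,
   where x_0 < y_0 < x_1 < y_1 < ... lie in [1/2, 3/4].  If g f_a h and g f_b h
   are both in W and a <= b, then f_b(h x_i) < f_a(h y_i), while f_b exceeds f_a
   by at least (b - a) c on h[1/2, 3/4], for some c > 0.  So f_a increases by at
   least (b - a) c on each of the n disjoint intervals [h x_i, h y_i], whence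
   (b - a) c n <= 1: the set of the a with g f_a h in W has measure O(1/n).

   On the other hand, for any n, every homeomorphism can be modified near the
   point 1/2 so as to zigzag n times inside an arbitrarily small box; countably
   many boxes suffice.  Giving the c-th box 2^(c+m) zigzags and taking the union
   over c, then the intersection over m, yields a dense G_delta set all of whose
   two-sided translates are null for the law of f_a. *)

Set Implicit Arguments.
Unset Strict Implicit.
Unset Printing Implicit Defensive.

Import Order.TTheory GRing.Theory Num.Theory.
Import numFieldNormedType.Exports.

Local Open Scope classical_set_scope.
Local Open Scope ring_scope.

(** * Homeomorphisms of [0,1] from increasing real functions *)

Section unit_interval.
Variable R : realType.
Local Notation I := (unit_itv R).
Implicit Types (f g : I -> I) (x y z : I).

Lemma unit_itv_ge0 x : 0 <= set_val x.
Proof. by have := set_valP x; rewrite /= in_itv/= => /andP[]. Qed.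

Lemma unit_itv_le1 x : set_val x <= 1.
Proof. by have := set_valP x; rewrite /= in_itv/= => /andP[]. Qed.

Lemma clamp01_subproof (r : R) :
  `[0%R : R, 1%R]%classic (Num.max 0 (Num.min r 1)).
Proof.
rewrite /= in_itv/= le_max lexx/= ge_max ler01/=.
by rewrite ge_min lexx orbT.
Qed.

(** Truncation is total on R, so points of the interval can be given by real expressions without
    carrying bounds. *)
Definition clamp01 (r : R) : I :=
  exist _ (Num.max 0 (Num.min r 1)) (mem_set (clamp01_subproof r)).

Lemma clamp01K (r : R) : 0 <= r <= 1 -> set_val (clamp01 r) = r.
Proof.
move=> /andP[r0 r1]; rewrite /clamp01 /= set_valE/=.
by rewrite (min_idPl r1) (max_idPr r0).
Qed.

Lemma ball_unit_itv x (e : R) y :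
  ball x e y = (`|set_val x - set_val y| < e) :> Prop.
Proof. by []. Qed.

Lemma set_val_unit_itv_continuous : continuous (set_val : I -> R).
Proof. exact: initial_continuous. Qed.

Lemma near_set_val_lt x (r : R) :
  set_val x < r -> \forall y \near x, set_val y < r.
Proof.
move=> xr; apply: (@set_val_unit_itv_continuous x [set s | s < r]).
exact: lt_nbhsl.
Qed.

Lemma near_set_val_gt x (r : R) :
  r < set_val x -> \forall y \near x, r < set_val y.
Proof.
move=> xr; apply: (@set_val_unit_itv_continuous x [set s | r < s]).
exact: lt_nbhsr.
Qed.

(** An increasing surjection has no jumps: preimages of f(x) - e and f(x) + e bound a neighbourhood
    of x on which f stays within e of f(x). If one of these values falls outside [0,1], the
    corresponding bound is automatic. *)
Lemma increasing_surj_continuous f :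
  (forall x y, set_val x < set_val y -> set_val (f x) < set_val (f y)) ->
  (forall y, exists x, f x = y) -> continuous f.
Proof.
move=> fi fs x P /nbhs_ballP[e /= e0 eP].
have up : \forall y \near x, set_val (f y) < set_val (f x) + e.
  have [l1|g1] := leP (set_val (f x) + e) 1; last first.
    apply: (@filterE _ (nbhs x) _) => y; apply: le_lt_trans g1.
    exact: unit_itv_le1.
  have [z fz] := fs (clamp01 (set_val (f x) + e)).
  have vz : set_val (f z) = set_val (f x) + e.
    by rewrite fz clamp01K// l1 andbT addr_ge0 ?unit_itv_ge0// ltW.
  have xz : set_val x < set_val z.
    rewrite ltNge le_eqVlt; apply/negP => /predU1P[/val_inj zx|/fi].
      by move: vz; rewrite zx; lra.
    by rewrite vz; lra.
  by rewrite -vz; apply: filterS (near_set_val_lt xz) => y; exact: fi.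
have dn : \forall y \near x, set_val (f x) - e < set_val (f y).
  have [l1|g1] := leP 0 (set_val (f x) - e); last first.
    apply: (@filterE _ (nbhs x) _) => y; apply: lt_le_trans g1 _.
    exact: unit_itv_ge0.
  have [z fz] := fs (clamp01 (set_val (f x) - e)).
  have vz : set_val (f z) = set_val (f x) - e.
    rewrite fz clamp01K// l1/=; have := unit_itv_le1 (f x); lra.
  have xz : set_val z < set_val x.
    rewrite ltNge le_eqVlt; apply/negP => /predU1P[/val_inj zx|/fi].
      by move: vz; rewrite zx; lra.
    by rewrite vz; lra.
  by rewrite -vz; apply: filterS (near_set_val_gt xz) => y; exact: fi.
apply: filterS (filterI dn up) => y [dy uy]; apply: eP.
by rewrite ball_unit_itv ltr_distlC dy.
Qed.

(** The inverse is again an increasing surjection, so the previous lemma gives continuity in both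
    directions. *)
Lemma increasing_surj_is_homeo f :
  (forall x y, set_val x < set_val y -> set_val (f x) < set_val (f y)) ->
  (forall y, exists x, f x = y) -> is_increasing_homeo f.
Proof.
move=> fi fs; split=> //; first exact: increasing_surj_continuous.
have [g fg] := choice fs; exists g.
have gf : cancel f g.
  move=> x; apply: val_inj; apply/eqP; rewrite eq_le !leNgt.
  by apply/andP; split; apply/negP => /fi; rewrite fg ltxx.
split=> //; apply: increasing_surj_continuous; last by move=> x; exists (f x).
move=> x y xy; rewrite ltNge le_eqVlt; apply/negP => /predU1P[/val_inj e|/fi].
  by move: xy; rewrite -(fg x) -(fg y) e ltxx.
by rewrite !fg => /(lt_trans xy); rewrite ltxx.
Qed.

Lemma homeo_of_real_fun (F : R -> R) :
  {homo F : r s / r < s} -> continuous F -> F 0 = 0 -> F 1 = 1 ->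
  {f : homeo R | forall x, set_val (homeo_fun f x) = F (set_val x)}.
Proof.
move=> Fi Fc F0 F1; pose f (x : I) := clamp01 (F (set_val x)).
have fF x : set_val (f x) = F (set_val x).
  have Fle := ltW_homo Fi.
  have := Fle _ _ (unit_itv_ge0 x); rewrite F0 => Fx0.
  have := Fle _ _ (unit_itv_le1 x); rewrite F1 => Fx1.
  by rewrite /f clamp01K// Fx0.
have fH : is_increasing_homeo f.
  apply: increasing_surj_is_homeo => [x y xy|y]; first by rewrite !fF; exact: Fi.
  have [r r01 Fr] : exists2 c, c \in `[0, 1] & F c = set_val y.
    apply: IVT => //; first exact: continuous_subspaceT.
    by rewrite F0 F1 min_l// max_r// unit_itv_ge0 unit_itv_le1.
  have e : set_val (f (clamp01 r)) = set_val y by rewrite fF clamp01K.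
  by exists (clamp01 r); exact: val_inj.
by exists (mk_homeo fH).
Qed.

End unit_interval.

(** * Prescribing finitely many values of a homeomorphism inside a box *)

Section box.
Variable R : realType.
Local Notation I := (unit_itv R).
Implicit Types (f g h : homeo R) (x y z : I).

Lemma affine_continuous (a b : R) : continuous (fun r : R => a * r + b).
Proof.
move=> r; apply: cvgD; last exact: cvg_cst.
by apply: cvgM; [exact: cvg_cst|exact: cvg_id].
Qed.

(** The graph runs linearly from (c,c) to (u,s) to (d,d) and along the diagonal elsewhere. As u <=
    s, this is the maximum of the diagonal and of the minimum of the two lines [l1] and [l2]. *)
Lemma push_up (c u s d : R) : 0 <= c -> c < u -> u <= s -> s < d -> d <= 1 ->
  exists h : homeo R, [/\ forall x, set_val x = u -> set_val (homeo_fun h x) = s,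
    forall x, set_val x <= c -> homeo_fun h x = x &
    forall x, d <= set_val x -> homeo_fun h x = x].
Proof.
move=> c0 cu us sd d1.
pose a1 := (s - c) / (u - c); pose a2 := (d - s) / (d - u).
have uc0 : 0 < u - c by rewrite subr_gt0.
have du0 : 0 < d - u by lra.
have a1u : a1 * (u - c) = s - c by rewrite /a1 divfK// gt_eqF.
have a2u : a2 * (d - u) = d - s by rewrite /a2 divfK// gt_eqF.
have a11 : 1 <= a1 by rewrite /a1 ler_pdivlMr// mul1r; lra.
have a20 : 0 < a2 by rewrite /a2 divr_gt0//; lra.
have a21 : a2 <= 1 by rewrite /a2 ler_pdivrMr// mul1r; lra.
pose l1 r := a1 * r + (c - a1 * c); pose l2 r := a2 * r + (d - a2 * d).
pose F (r : R) := Num.max r (Num.min (l1 r) (l2 r)).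
have Fc : continuous F.
  move=> r; apply: (@continuous_max R R id (fun t => Num.min (l1 t) (l2 t))).
    exact: cvg_id.
  by apply: (@continuous_min R R l1 l2); exact: affine_continuous.
have l1i : {homo l1 : r t / r < t} by move=> r t rt; rewrite /l1; nra.
have l2i : {homo l2 : r t / r < t} by move=> r t rt; rewrite /l2; nra.
have Fi : {homo F : r t / r < t}.
  move=> r t rt; rewrite /F gt_max !lt_max rt/= lt_min !gt_min.
  by rewrite (l1i _ _ rt) (l2i _ _ rt) !orbT.
have Flow r : r <= c -> F r = r.
  move=> rc; rewrite /F max_l// ge_min; apply/orP; left; rewrite /l1; nra.
have Fhigh r : d <= r -> F r = r.
  move=> rc; rewrite /F max_l// ge_min; apply/orP; right; rewrite /l2; nra.
have [h hF] := homeo_of_real_fun Fi Fc (Flow _ c0) (Fhigh _ d1).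
exists h; split=> x xE.
- have l1u : l1 u = s by rewrite /l1; lra.
  have l2u : l2 u = s by rewrite /l2; lra.
  by rewrite hF xE /F l1u l2u min_l// max_r.
- by apply: val_inj; exact: etrans (hF x) (Flow _ xE).
- by apply: val_inj; exact: etrans (hF x) (Fhigh _ xE).
Qed.

Lemma homeo_lt f x y : set_val x < set_val y ->
  set_val (homeo_fun f x) < set_val (homeo_fun f y).
Proof. by have [fi _ _] := homeo_funP f; exact: fi. Qed.

Lemma homeo_le f x y : set_val x <= set_val y ->
  set_val (homeo_fun f x) <= set_val (homeo_fun f y).
Proof.
rewrite le_eqVlt => /predU1P[/val_inj ->//|/(homeo_lt f)]; exact: ltW.
Qed.

Lemma homeo_ltW f x y : set_val (homeo_fun f x) < set_val (homeo_fun f y) ->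
  set_val x < set_val y.
Proof. by apply: contraTT; rewrite -!leNgt; exact: homeo_le. Qed.

(** The graph of f is bent only inside the box (p,q) x (f p, f q): f is followed by a map that moves
    f t to s and fixes everything outside (f p, f q). *)
Lemma homeo_box (p t q s : I) f :
  set_val p < set_val t -> set_val t < set_val q ->
  set_val (homeo_fun f p) < set_val s -> set_val s < set_val (homeo_fun f q) ->
  exists g, [/\ homeo_fun g t = s,
    forall x, set_val x <= set_val p -> homeo_fun g x = homeo_fun f x &
    forall x, set_val q <= set_val x -> homeo_fun g x = homeo_fun f x].
Proof.
move=> pt tq ps sq; set u := homeo_fun f t.
have pu : set_val (homeo_fun f p) < set_val u := homeo_lt f pt.
have uq : set_val u < set_val (homeo_fun f q) := homeo_lt f tq.
suff [h [hu hlow hhigh]] : exists h, [/\ homeo_fun h u = s,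
    forall x, set_val x <= set_val (homeo_fun f p) -> homeo_fun h x = x &
    forall x, set_val (homeo_fun f q) <= set_val x -> homeo_fun h x = x].
  exists (h * f)%g; split=> // x xE; [apply: hlow|apply: hhigh]; exact: homeo_le.
(* Pushing [u] down to [s] is the inverse of pushing [s] up to [u]. *)
have [us|/ltW su] := leP (set_val u) (set_val s).
  have [h [hu hl hh]] := push_up (unit_itv_ge0 _) pu us sq (unit_itv_le1 _).
  by exists h; split=> //; apply: val_inj; exact: hu.
have [h [hs hl hh]] := push_up (unit_itv_ge0 _) ps su uq (unit_itv_le1 _).
exists (h^-1)%g; split=> [|x xE|x xE].
- have <- : homeo_fun h s = u by apply: val_inj; exact: hs.
  exact: homeo_invK.
- by rewrite -{1}(hl x xE); exact: homeo_invK.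
- by rewrite -{1}(hh x xE); exact: homeo_invK.
Qed.

(** Induction on n: [homeo_box] between [x n] and [q] sets the next value and leaves all earlier
    ones alone. *)
Lemma homeo_interpolation n (x y : nat -> I) (q : I) f :
  y 0%N = homeo_fun f (x 0%N) ->
  (forall j, (j < n)%N -> set_val (x j) < set_val (x j.+1)) ->
  (forall j, (j < n)%N -> set_val (y j) < set_val (y j.+1)) ->
  set_val (x n) < set_val q -> set_val (y n) < set_val (homeo_fun f q) ->
  exists g, [/\ forall j, (j <= n)%N -> homeo_fun g (x j) = y j,
    forall z, set_val z <= set_val (x 0%N) -> homeo_fun g z = homeo_fun f z &
    forall z, set_val q <= set_val z -> homeo_fun g z = homeo_fun f z].
Proof.
move=> y0; elim: n => [|n IHn] xi yi xq yq.
  by exists f; split=> // j; rewrite leqn0 => /eqP ->.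
have [||||g [gxy gl gh]] := IHn.
- by move=> j jn; apply: xi; rewrite ltnS ltnW.
- by move=> j jn; apply: yi; rewrite ltnS ltnW.
- exact: lt_trans (xi _ (ltnSn n)) xq.
- exact: lt_trans (yi _ (ltnSn n)) yq.
have le_x j k : (j + k <= n)%N -> set_val (x j) <= set_val (x (j + k)%N).
  elim: k => [|k IHk]; rewrite ?addn0// addnS => jkn.
  by apply: le_trans (IHk (ltnW jkn)) (ltW (xi _ _)); exact: ltnW.
have [||||g' [g'x g'l g'h]] := @homeo_box (x n) (x n.+1) q (y n.+1) g.
- exact: xi.
- exact: xq.
- by rewrite gxy//; exact: yi.
- by rewrite gh.
exists g'; split=> [j|z z0|z qz].
- rewrite leq_eqVlt => /predU1P[->//|]; rewrite ltnS => jn.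
  by rewrite g'l ?gxy//; have := @le_x j (n - j)%N; rewrite subnKC//; apply.
- by rewrite g'l ?gl//; apply: le_trans z0 (le_x 0 n _).
- by rewrite g'h ?gh.
Qed.

End box.

(** * Zigzag sets: openness, and approximation by zigzagging homeomorphisms *)

Section zigzag.
Variable R : realType.
Local Notation I := (unit_itv R).
Implicit Types (f g h : homeo R) (x y z : I).

(* For j <= 2n, these points lie in [1/2, 1/2 + 1/(4(k+1))], and for j <= 4n the
   values below lie in [p/(k+1), (p+1)/(k+1)]; the even-numbered values are those
   interpolated in [zigzag_dense], the others separate them. *)
Definition zigzag_pt (k n j : nat) : R :=
  2^-1 + (j%:R / n%:R) / (8 * k.+1%:R).

Definition zigzag_val (k p n j : nat) : R :=
  (p%:R + (j%:R / n%:R) / 4) / k.+1%:R.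

(** In the notation of the opening comment, x_i and y_i are the points of index 2i and 2i+1, and s_i
    is the value of index 4i+1. It separates the values 4i and 4i+2, which the approximating
    homeomorphism takes at x_i and y_i. *)
Definition zigzag (k p n : nat) : set (homeo R) := [set f | forall i : 'I_n,
  set_val (homeo_fun f (clamp01 (zigzag_pt k n (2 * i)))) <
    zigzag_val k p n (4 * i).+1 <
  set_val (homeo_fun f (clamp01 (zigzag_pt k n (2 * i).+1)))].

Lemma zigzag_pt_ge k n j : 2^-1 <= zigzag_pt k n j.
Proof. by rewrite /zigzag_pt lerDl mulr_ge0// ?invr_ge0 ?mulr_ge0 ?invr_ge0. Qed.

Lemma zigzag_pt_lt k n i j : (0 < n)%N -> (i < j)%N ->
  zigzag_pt k n i < zigzag_pt k n j.
Proof.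
move=> n0 ij; rewrite /zigzag_pt ltrD2l ltr_pM2r ?invr_gt0 ?mulr_gt0//.
by rewrite ltr_pM2r ?invr_gt0 ?ltr0n// ltr_nat.
Qed.

Lemma zigzag_pt_le k n j : (j <= 2 * n)%N ->
  zigzag_pt k n j <= 2^-1 + k.+1%:R^-1 / 4.
Proof.
case: n => [|n] jn.
  by rewrite /zigzag_pt invr0 mulr0 mul0r addr0 lerDl mulr_ge0.
have : j%:R / n.+1%:R <= 2 :> R by rewrite ler_pdivrMr// -natrM ler_nat.
have : 0 < k.+1%:R^-1 :> R by rewrite invr_gt0.
rewrite /zigzag_pt lerD2l invfM; move: (j%:R / n.+1%:R) (k.+1%:R^-1) => q u u0 q2.
nra.
Qed.

Lemma zigzag_pt01 k n j : (j <= 2 * n)%N -> 0 <= zigzag_pt k n j <= 1.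
Proof.
move=> jn; have := zigzag_pt_ge k n j; have := zigzag_pt_le k jn.
have : k.+1%:R^-1 <= 1 :> R by rewrite invf_le1// ler1n.
move: (k.+1%:R^-1) (zigzag_pt _ _ _) => u t u1 t2 t1; apply/andP; split; lra.
Qed.

Lemma zigzag_val_lt k p n i j : (0 < n)%N -> (i < j)%N ->
  zigzag_val k p n i < zigzag_val k p n j.
Proof.
move=> n0 ij; rewrite /zigzag_val ltr_pM2r ?invr_gt0// ltrD2l.
by rewrite ltr_pM2r ?invr_gt0// ltr_pM2r ?invr_gt0 ?ltr0n// ltr_nat.
Qed.

Lemma zigzag_val_ge k p n j : p%:R / k.+1%:R <= zigzag_val k p n j.
Proof.
by rewrite /zigzag_val ler_pM2r ?invr_gt0// lerDl mulr_ge0.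
Qed.

Lemma zigzag_val_le k p n j : (0 < n)%N -> (j <= 4 * n)%N ->
  zigzag_val k p n j <= (p%:R + 1) / k.+1%:R.
Proof.
move=> n0 jn; rewrite /zigzag_val ler_pM2r ?invr_gt0// lerD2l.
by rewrite ler_pdivrMr// mul1r ler_pdivrMr ?ltr0n// -natrM ler_nat.
Qed.

Lemma homeo_eval_continuous x :
  continuous (fun f : homeo R => set_val (homeo_fun f x)).
Proof.
move=> f P /nbhs_ballP[e /= e0 eP]; apply/homeo_nbhsP.
exists [set xy | ball xy.1 e xy.2]; last by move=> g /(_ x) ?; exact: eP.
by rewrite -entourage_ballE; exists e.
Qed.

Lemma zigzag_open k p n : open (zigzag k p n).
Proof.
rewrite openE => f fW; apply: (@filter_forall _ _ _ (nbhs f) _) => i.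
have /andP[/lt_nbhsl lo /lt_nbhsr hi] := fW i.
have {}lo := homeo_eval_continuous lo; have {}hi := homeo_eval_continuous hi.
by near do (apply/andP; split); [exact: lo|exact: hi].
Unshelve. all: by end_near.
Qed.

Lemma homeo_gt0 f x : 0 < set_val x -> 0 < set_val (homeo_fun f x).
Proof.
move=> x0; apply: le_lt_trans (unit_itv_ge0 (homeo_fun f (clamp01 0))) _.
by apply: homeo_lt; rewrite clamp01K// lexx ler01.
Qed.

Lemma homeo_lt1 f x : set_val x < 1 -> set_val (homeo_fun f x) < 1.
Proof.
move=> x1; apply: lt_le_trans (unit_itv_le1 (homeo_fun f (clamp01 1))).
by apply: homeo_lt; rewrite clamp01K// lexx ler01.
Qed.

(** The cell (k,p) depends on f and E alone, so the number n of zigzags may be chosen afterwards,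
    even as a function of (k,p). The map g agrees with f outside (p0,q0), and both send this
    interval into (v - eta, v + eta). *)
Lemma zigzag_dense f (E : set (I * I)) : entourage E ->
  exists k p, forall n, (0 < n)%N ->
    exists2 g, zigzag k p n g & forall x, E (homeo_fun f x, homeo_fun g x).
Proof.
rewrite -entourage_ballE => -[e /= e0 eE].
have h01 : 0 <= (2^-1 : R) <= 1 by lra.
pose v := set_val (homeo_fun f (clamp01 2^-1)).
have v0 : 0 < v by apply: homeo_gt0; rewrite clamp01K//; lra.
have v1 : v < 1 by apply: homeo_lt1; rewrite clamp01K//; lra.
(* The term e/3 makes 2 eta < e; the other two keep v - eta and v + eta inside (0,1). *)
pose eta := Num.min (e / 3) (Num.min (v / 2) ((1 - v) / 2)).
have eta0 : 0 < eta by rewrite !lt_min; do ?[apply/andP; split]; lra.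
have etae : eta <= e / 3 by rewrite /eta ge_min lexx.
have etav : eta <= v / 2 by rewrite /eta !ge_min lexx orbT.
have eta1 : eta <= (1 - v) / 2 by rewrite /eta !ge_min lexx !orbT.
pose p0 := homeo_fun (f^-1)%g (clamp01 (v - eta)).
pose q0 := homeo_fun (f^-1)%g (clamp01 (v + eta)).
have fp : set_val (homeo_fun f p0) = v - eta.
  by rewrite homeo_invVK clamp01K//; lra.
have fq : set_val (homeo_fun f q0) = v + eta.
  by rewrite homeo_invVK clamp01K//; lra.
have p0h : set_val p0 < 2^-1.
  rewrite -[ltRHS]clamp01K//; apply: (@homeo_ltW _ f); rewrite fp -/v; lra.
have q0h : 2^-1 < set_val q0.
  rewrite -[ltLHS]clamp01K//; apply: (@homeo_ltW _ f); rewrite fq -/v; lra.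
(* A mesh below eta puts the cell containing v inside (v - eta, v + eta); a mesh below q0 - 1/2 puts
   the zigzag points to the left of q0. *)
have [k] : exists k, 0 + k.+1%:R^-1 < Num.min eta (set_val q0 - 2^-1).
  by apply: ltr_add_invr; rewrite lt_min eta0 subr_gt0.
rewrite add0r lt_min => /andP[keta kq].
have K0 : 0 < k.+1%:R :> R by [].
pose p := Num.truncn (v * k.+1%:R).
have /andP[pv vp] : p%:R <= v * k.+1%:R < p.+1%:R.
  by apply: truncn_itv; rewrite mulr_ge0// ltW.
have lo : v - eta < p%:R / k.+1%:R.
  have : v < p%:R / k.+1%:R + k.+1%:R^-1.
    by rewrite -[X in _ + X]mul1r -mulrDl ltr_pdivlMr// natr1.
  by move: (k.+1%:R^-1) (_ / _) keta => u w; lra.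
have hi : (p%:R + 1) / k.+1%:R < v + eta.
  by rewrite mulrDl mul1r ler_ltD// ler_pdivrMr.
exists k, p => n n0.
have val01 j : (j <= 4 * n)%N -> 0 <= zigzag_val k p n j <= 1.
  move=> jn; rewrite (le_trans _ (zigzag_val_ge k p n j)) ?divr_ge0//=.
  by apply: le_trans (zigzag_val_le k p n0 jn) (ltW (lt_le_trans hi _)); lra.
(* Node 0 is p0, where the value of f is kept; this shifts the zigzag points by one index. Only
   even-numbered values are interpolated. *)
pose x j := if j is i.+1 then clamp01 (zigzag_pt k n i) else p0.
pose y j := if j is i.+1 then clamp01 (zigzag_val k p n (2 * i))
  else homeo_fun f p0.
have ptK j : (j < 2 * n)%N ->
    set_val (clamp01 (zigzag_pt k n j)) = zigzag_pt k n j.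
  by move=> jn; rewrite clamp01K// zigzag_pt01// ltnW.
have valK j : (j < 2 * n)%N -> set_val (clamp01 (zigzag_val k p n (2 * j))) =
    zigzag_val k p n (2 * j).
  by move=> jn; rewrite clamp01K// val01//; clear -jn; lia.
have [|||||g [gxy gl gh]] := @homeo_interpolation R (2 * n) x y q0 f; first by [].
- move=> [|j] jn /=.
    by rewrite ptK//; exact: lt_le_trans p0h (zigzag_pt_ge _ _ _).
  by rewrite !ptK ?(ltnW jn)//; exact: zigzag_pt_lt.
- move=> [|j] jn /=.
    by rewrite valK// fp; exact: lt_le_trans lo (zigzag_val_ge _ _ _ _).
  by rewrite !valK ?(ltnW jn)//; apply: zigzag_val_lt => //; clear; lia.
- rewrite /x; case nE : (2 * n)%N => [|j]; first exact: lt_trans q0h.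
  have jn : (j < 2 * n)%N by rewrite nE.
  rewrite ptK//; apply: le_lt_trans (zigzag_pt_le k (ltnW jn)) _.
  have : 0 < k.+1%:R^-1 :> R by rewrite invr_gt0.
  by move: (k.+1%:R^-1) kq => u; lra.
- rewrite /y fq; case nE : (2 * n)%N => [|j]; first by rewrite fp; lra.
  have jn : (j < 2 * n)%N by rewrite nE.
  rewrite valK//; apply: le_lt_trans hi; apply: zigzag_val_le => //.
  by clear -jn; lia.
exists g.
  move=> i; have i1 : (2 * i < 2 * n)%N by rewrite ltn_pmul2l.
  have i2 : ((2 * i).+1 < 2 * n)%N by move: (ltn_ord i); clear; lia.
  rewrite (gxy (2 * i).+1)// (gxy (2 * i).+2)//= !valK//.
  by apply/andP; split; apply: zigzag_val_lt => //; clear; lia.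
move=> z; apply: eE; rewrite /= ball_unit_itv.
have [zp|pz] := leP (set_val z) (set_val p0); first by rewrite gl// subrr normr0.
have [qz|zq] := leP (set_val q0) (set_val z); first by rewrite gh// subrr normr0.
have := homeo_lt f pz; have := homeo_lt f zq; have := homeo_lt g pz.
have := homeo_lt g zq.
rewrite (gl p0)// (gh q0)// fp fq => ? ? ? ?.
by rewrite ltr_norml; apply/andP; split; lra.
Qed.

End zigzag.

(** * The tent family f_a and its spread inside a zigzag set *)

Section tent.
Variable R : realType.
Local Notation I := (unit_itv R).
Implicit Types (f g h : homeo R) (x y z : I).

(** For a >= 0 this is r + (a/2) min(r, 1 - r), the f_a of the opening comment. The [+ 0] gives both
    branches the shape treated by [affine_continuous]. *)
Definition tent_fun (a r : R) : R :=
  Num.min ((1 + a / 2) * r + 0) ((1 - a / 2) * r + a / 2).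

Lemma tent_subproof x : {f : homeo R |
  forall y, set_val (homeo_fun f y) = tent_fun (set_val x) (set_val y)}.
Proof.
have a0 := unit_itv_ge0 x; have a1 := unit_itv_le1 x.
apply: homeo_of_real_fun.
- move=> r t rt; rewrite /tent_fun lt_min !gt_min.
  by apply/andP; split; apply/orP; [left|right]; nra.
- move=> r; pose a : R := set_val x.
  by apply: (@continuous_min R R (fun t => (1 + a / 2) * t + 0)
    (fun t => (1 - a / 2) * t + a / 2)); exact: affine_continuous.
- by rewrite /tent_fun !mulr0 !add0r min_l// divr_ge0.
- by rewrite /tent_fun !mulr1 subrK addr0 min_r// lerDl divr_ge0.
Qed.

(* The parameter is clamped to [0,1], so that [tent] is total on [R]. *)
Definition tent (a : R) : homeo R := sval (tent_subproof (clamp01 a)).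

Lemma tentE (a : R) y :
  set_val (homeo_fun (tent a) y) = tent_fun (set_val (clamp01 a)) (set_val y).
Proof. exact: (svalP (tent_subproof (clamp01 a)) y). Qed.

Lemma tent_fun_lip (a b r : R) : 0 <= r <= 1 ->
  `|tent_fun a r - tent_fun b r| <= `|a - b|.
Proof.
move=> /andP[r0 r1]; rewrite /tent_fun.
wlog ab : a b / a <= b.
  move=> H; have [/H//|/ltW/H] := leP a b.
  by rewrite distrC [`|b - a|]distrC.
rewrite ler_distlC; rewrite ler0_norm ?subr_le0// opprB.
case: (leP ((1 + a / 2) * r + 0) _) => h1;
  case: (leP ((1 + b / 2) * r + 0) _) => h2;
  apply/andP; split; nra.
Qed.

Lemma clamp01_continuous : continuous (fun a : R => set_val (clamp01 a)).
Proof.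
move=> a; apply: (@continuous_max R R (fun=> 0) (fun a => Num.min a 1)).
  exact: cvg_cst.
by apply: (@continuous_min R R id (fun=> 1)); [exact: cvg_id|exact: cvg_cst].
Qed.

(** The Lipschitz bound in the parameter is uniform in the point, hence continuity for the uniform
    topology; this is what makes [tent] Borel measurable. *)
Lemma tent_continuous : continuous tent.
Proof.
move=> a P /homeo_nbhsP[E]; rewrite -entourage_ballE => -[e /= e0 eE] EP.
have : \forall b \near a, ball (set_val (clamp01 a)) e (set_val (clamp01 b)).
  exact: (clamp01_continuous (nbhsx_ballx _ _ e0)).
apply: (@filterS _ (nbhs a)) => b /= ab; apply: EP => x; apply: eE.
rewrite /= ball_unit_itv !tentE; apply: le_lt_trans ab.
by apply: tent_fun_lip; rewrite unit_itv_ge0 unit_itv_le1.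
Qed.

(** Here f_b(r) - f_a(r) = (b - a)/2 min(r, 1 - r), and on [lo, hi] the last factor is at least
    min(lo, 1 - hi). *)
Lemma tent_gap (a b lo hi : R) y : 0 <= a -> a <= b -> b <= 1 ->
  lo <= set_val y <= hi ->
  set_val (homeo_fun (tent a) y) + (b - a) * (Num.min lo (1 - hi) / 2) <=
  set_val (homeo_fun (tent b) y).
Proof.
move=> a0 ab b1 /andP[ly yh]; rewrite !tentE !clamp01K; last 2 first.
  by rewrite b1 (le_trans a0).
  by rewrite a0 (le_trans ab).
have m1 : Num.min lo (1 - hi) <= lo by rewrite ge_min lexx.
have m2 : Num.min lo (1 - hi) <= 1 - hi by rewrite ge_min lexx orbT.
rewrite /tent_fun.
move: (Num.min lo _) (set_val y) ly yh m1 m2 => m r ly yh m1 m2.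
rewrite le_min; apply/andP; split.
  apply: (@le_trans _ _ ((1 + a / 2) * r + 0 + (b - a) * (m / 2))); last by nra.
  by rewrite lerD2r ge_min lexx.
apply: (@le_trans _ _ ((1 - a / 2) * r + a / 2 + (b - a) * (m / 2))); last by nra.
by rewrite lerD2r ge_min lexx orbT.
Qed.

(** The constant comes from h alone: all zigzag points lie in [1/2, 3/4], whose image [lo, hi] under
    h stays away from 0 and 1. *)
Lemma zigzag_tent_gap g h : exists2 c : R, 0 < c & forall k p n (a b : R),
  0 <= a -> a <= b -> b <= 1 ->
  zigzag k p n (g * tent a * h)%g -> zigzag k p n (g * tent b * h)%g ->
  (b - a) * c * n%:R <= 1.
Proof.
have h2 : 0 <= (2^-1 : R) <= 1 by lra.
have h3 : 0 <= (3 / 4 : R) <= 1 by lra.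
pose lo := set_val (homeo_fun h (clamp01 2^-1)).
pose hi := set_val (homeo_fun h (clamp01 (3 / 4))).
have lo0 : 0 < lo by apply: homeo_gt0; rewrite clamp01K//; lra.
have hi1 : hi < 1 by apply: homeo_lt1; rewrite clamp01K//; lra.
exists (Num.min lo (1 - hi) / 2).
  by rewrite divr_gt0// lt_min lo0 subr_gt0.
move=> k p n a b a0 ab b1 za zb; set c := Num.min _ _ / 2.
pose x j := homeo_fun h (clamp01 (zigzag_pt R k n j)).
pose D j := set_val (homeo_fun (tent a) (x j)).
have jump i : (i < n)%N -> (b - a) * c <= D (2 * i).+1 - D (2 * i)%N.
  move=> iN; pose i' := Ordinal iN.
  have /andP[bs _] := zb i'; have /andP[_ sa] := za i'.
  (* As g is increasing, it cancels from g f_b h x_i < s_i < g f_a h y_i. *)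
  have {bs sa} := lt_trans bs sa => /(homeo_ltW (f := g)) bxa.
  have xlohi : lo <= set_val (x (2 * i)%N) <= hi.
    have jn : (2 * i <= 2 * n)%N by rewrite leq_mul2l ltnW.
    have pt01 := zigzag_pt01 R k jn.
    have pt_ge := zigzag_pt_ge R k n (2 * i); have pt_le := zigzag_pt_le R k jn.
    have : k.+1%:R^-1 <= 1 :> R by rewrite invf_le1// ler1n.
    move: (k.+1%:R^-1) pt_le => u pt_le u1.
    by apply/andP; split; apply: homeo_le; rewrite !clamp01K//; lra.
  have := tent_gap a0 ab b1 xlohi; rewrite -/c => gap.
  by rewrite lerBrDl; apply: le_trans gap (ltW bxa).
(* From the end of one zigzag to the start of the next, D does not decrease, so the n jumps add
   up. *)
have Dle i : (i.+1 < n)%N -> D (2 * i).+1 <= D (2 * i.+1)%N.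
  move=> iN; apply: homeo_le; apply: homeo_le.
  have jn : (2 * i.+1 <= 2 * n)%N by rewrite leq_mul2l ltnW.
  have jn' : ((2 * i).+1 <= 2 * n)%N by move: jn; clear; lia.
  rewrite !clamp01K ?zigzag_pt01// ltW// zigzag_pt_lt//.
    by rewrite (leq_ltn_trans _ iN).
  by clear; lia.
have sumD m : (m < n)%N -> (b - a) * c * m.+1%:R <= D (2 * m).+1 - D 0%N.
  elim: m => [n0|m IHm mn]; first by rewrite mulr1; exact: jump.
  have := IHm (ltnW mn); have := jump _ mn; have := Dle _ mn.
  rewrite -natr1 mulrDr mulr1; move: ((b - a) * c) => t; lra.
case: n @x @D za zb jump Dle sumD => [|n] x D za zb jump Dle sumD.
  by rewrite mulr0.
apply: le_trans (sumD _ (ltnSn n)) _.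
by rewrite lerBlDr (le_trans (unit_itv_le1 _))// lerDl unit_itv_ge0.
Qed.

End tent.


(** * Uniform measure of sets of small diameter, translates, Borel maps, nowhere dense sets *)

Lemma uniform_prob_diam (R : realType) (S : set R) (d : R) :
  0 <= d -> measurable S ->
  (forall a b, S a -> S b -> 0 <= a -> a <= b -> b <= 1 -> b - a <= d) ->
  (uniform_prob (@ltr01 R) S <= (2 * d)%:E)%E.
Proof.
move=> d0 mS dS; rewrite /uniform_prob integral_uniform_pdf.
have [->|/set0P[a [Sa]]] := eqVneq (S `&` `[0%R : R, 1%R]) set0.
  by rewrite integral_set0 lee_fin mulr_ge0.
rewrite /= in_itv/= => /andP[a0 a1].
(* Any point a of S in [0,1] serves as centre: the rest of S in [0,1] is within d of it, and the
   density is at most 1 on this interval of length 2d. *)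
apply: (@le_trans _ _
    (\int[@lebesgue_measure R]_(x in `[(a - d)%R, (a + d)%R]) (uniform_pdf 0 1 x)%:E)%E).
  apply: ge0_subset_integral => //.
  - exact: measurableI.
  - by apply/measurable_EFinP/measurable_funTS; exact: measurable_uniform_pdf.
  - by move=> x _; rewrite lee_fin uniform_pdf_ge0.
  - move=> b [Sb]; rewrite /= !in_itv/= => /andP[b0 b1].
    have [ab|/ltW ba] := leP a b.
      by have := dS _ _ Sa Sb; lra.
    by have := dS _ _ Sb Sa; lra.
apply: (@le_trans _ _
    (\int[@lebesgue_measure R]_(x in `[(a - d)%R, (a + d)%R]) (cst 1%:E x))%E).
  apply: ge0_le_integral => //.
  - by move=> x _; rewrite lee_fin uniform_pdf_ge0.
  - by apply/measurable_EFinP/measurable_funTS; exact: measurable_uniform_pdf.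
  - move=> x _; rewrite lee_fin /uniform_pdf; case: ifP => // _.
    by rewrite subr0 invr1.
rewrite integral_cst//= mul1e lebesgue_measure_itv/=; case: ifP => _.
  by rewrite -EFinD lee_fin; lra.
by rewrite lee_fin mulr_ge0.
Qed.

Lemma translate_continuous (G : topGroupType) (g h : G) :
  continuous (fun x : G => (g * x * h)%g).
Proof.
move=> x; apply: (@continuous_comp _ _ _ (fun x => (g * x, h)%g)
  (fun p : G * G => (p.1 * p.2)%g)); last exact: mulg_continuous.
apply: cvg_pair; last exact: cvg_cst.
apply: (@continuous_comp _ _ _ (fun x => (g, x))
  (fun p : G * G => (p.1 * p.2)%g)).
  by apply: cvg_pair; [exact: cvg_cst|exact: cvg_id].
exact: mulg_continuous.
Qed.

Lemma open_translate (G : topGroupType) (g h : G) (A : set G) : open A ->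
  open [set x | A (g * x * h)%g].
Proof. by move=> oA; apply: open_comp => // x _; exact: translate_continuous. Qed.

(** A translate becomes a preimage under the inverse translation, the form suited to continuity and
    to the law of a random variable. *)
Lemma image_translateE (G : topGroupType) (g h : G) (A : set G) :
  [set (g * x * h)%g | x in A] = [set x | A (g^-1 * x * h^-1)%g].
Proof.
apply/seteqP; split=> [_ [x Ax <-]|x Ax] /=.
  by rewrite !mulgA mulVg mul1g mulgK.
by exists (g^-1 * x * h^-1)%g => //; rewrite !mulgA mulgV mul1g mulgVK.
Qed.

Lemma continuous_borel_measurable (R : realType) (G : ptopologicalType)
    (f : R -> G) :
  continuous f -> measurable_fun setT (f : measurableTypeR R -> borel_type G).
Proof.
move=> fc.
refine (@measurability _ _ (measurableTypeR R) (borel_type G) setT f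
  (@open G) _ _) => //.
move=> _ [A oA <-]; rewrite setTI; apply: open_measurable.
by apply: open_comp => // x _; exact: fc.
Qed.

Lemma nowhere_dense_setC (T : topologicalType) (V : set T) :
  open V -> dense V -> nowhere_dense (~` V).
Proof.
move=> oV dV; rewrite /nowhere_dense -((closure_id (~` V)).1 (open_closedC oV)).
apply/eqP/negPn/negP => /set0P iV0.
have [x [/interior_subset nVx Vx]] := dV _ iV0 (@open_interior _ _).
exact: nVx.
Qed.

(** * The dense G_delta set and the nullity of its translates *)

Section zigzag_null.
Variable R : realType.

(** The number c encodes (k,p); numbers that encode no pair default to (0,0). Such boxes are
    harmless, as the measure estimate only uses the number 2^(c+m) of zigzags. *)
Definition zigzag_box (m c : nat) : set (homeo R) :=
  let: (k, p) := odflt (0, 0)%N (unpickle c) in zigzag k p (2 ^ (c + m)).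

Definition zigzag_union (m : nat) : set (homeo R) := \bigcup_c zigzag_box m c.

Lemma zigzag_box_open m c : open (zigzag_box m c).
Proof. by rewrite /zigzag_box; case: (odflt _ _) => k p; exact: zigzag_open. Qed.

Lemma zigzag_union_dense m : dense (zigzag_union m).
Proof.
move=> O [f Of] oO.
have /homeo_nbhsP[E entE EO] : nbhs f O by exact: open_nbhs_nbhs.
have [k [p zd]] := zigzag_dense f entE.
(* The box is fixed first; its code c then dictates the number of zigzags. *)
pose c := pickle (k, p); have [|g zg fg] := zd (2 ^ (c + m))%N.
  by rewrite expn_gt0.
by exists g; split; [exact: EO|exists c => //; rewrite /zigzag_box pickleK].
Qed.

Lemma measurable_tent_translate (g h : homeo R) (A : set (homeo R)) :
  open A -> measurable [set a : measurableTypeR R | A (g * tent a * h)%g].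
Proof.
move=> oA; apply: open_measurable.
apply: (@open_comp _ _ (@tent R) [set x | A (g * x * h)%g]).
  by move=> x _; exact: tent_continuous.
exact: open_translate.
Qed.

Definition tent_rv : {mfun measurableTypeR R >-> borel_type (homeo R)} :=
  mfun_Sub (mem_set (continuous_borel_measurable (@tent_continuous R))).

Definition tent_law : probability (borel_type (homeo R)) R :=
  distribution (uniform_prob (@ltr01 R)) tent_rv.

(** The parameters of this set in [0,1] are at most 1/(r 2^(c+m)) apart, with r from
    [zigzag_tent_gap], and [uniform_prob_diam] doubles this. The factor 1/2^(c+1) is split off so
    that the bounds sum over c to C/2^m. *)
Lemma zigzag_box_law (g h : homeo R) : exists2 C : R, 0 < C & forall m c,
  (uniform_prob (@ltr01 R) [set a | zigzag_box m c (g * tent a * h)%g] <=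
   ((C / 2 ^+ m) / (2 ^ c.+1)%:R)%:E)%E.
Proof.
have [r r0 gap] := zigzag_tent_gap g h.
exists (4 / r); first by rewrite divr_gt0.
move=> m c; have n0 : 0 < 2 ^+ (c + m) :> R by rewrite exprn_gt0.
have -> : 4 / r / 2 ^+ m / (2 ^ c.+1)%:R = 2 * (r * 2 ^+ (c + m))^-1 :> R.
  rewrite natrX exprS exprD; field.
  by rewrite !expf_neq0 ?gt_eqF.
apply: uniform_prob_diam.
- by rewrite invr_ge0 mulr_ge0 ?ltW.
- exact: measurable_tent_translate (zigzag_box_open m c).
- move=> a b; rewrite /= /zigzag_box; case: (odflt _ _) => k p za zb a0 ab b1.
  rewrite -[leRHS]mul1r ler_pdivlMr ?mulr_gt0// mulrA -natrX.
  exact: gap za zb.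
Qed.

Lemma zigzag_haar_null : borel_haar_null R (\bigcap_m zigzag_union m).
Proof.
split.
  apply: bigcap_measurable => // m _; apply: bigcup_measurable => c _.
  exact: sub_sigma_algebra (zigzag_box_open m c).
exists tent_law => g h; rewrite image_translateE.
have [C C0 PC] := zigzag_box_law g^-1%g h^-1%g.
pose A m c :=
  [set a : measurableTypeR R | zigzag_box m c (g^-1 * tent a * h^-1)%g].
have mA m c : measurable (A m c).
  exact: measurable_tent_translate (zigzag_box_open m c).
have mS : measurable (\bigcap_m \bigcup_c A m c).
  by apply: bigcap_measurable => // m _; exact: bigcup_measurable.
(* By definition, the law of a set is the uniform probability of its preimage under [tent]. *)
change (uniform_prob (@ltr01 R) (\bigcap_m \bigcup_c A m c) = 0%E).
apply/eqP; rewrite eq_le measure_ge0 andbT; apply/lee_addgt0Pr => e e0.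
rewrite add0e.
(* Since m + 1 <= 2^m, this choice makes C/2^m at most e. *)
have [m] : exists m, 0 + m.+1%:R^-1 < e / C.
  by apply: ltr_add_invr; rewrite divr_gt0.
rewrite add0r => me.
have Cm : C / 2 ^+ m <= e.
  rewrite mulrC -ler_pdivlMr//; apply: le_trans (ltW me).
  by rewrite lef_pV2 ?posrE ?exprn_gt0// -natrX ler_nat ltn_expl.
apply: (@le_trans _ _ (C / 2 ^+ m)%:E); last by rewrite lee_fin.
have Cm0 : 0 <= C / 2 ^+ m by rewrite divr_ge0 ?exprn_ge0// ltW.
(* The intersection lies in its m-th term, whose boxes contribute at most (C/2^m)/2^(c+1) each, a
   geometric series. *)
apply: le_trans (epsilon_trick0 xpredT Cm0).
apply: (le_trans (measure_sigma_subadditive _ (mA m) mS _)).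
  by move=> a /(_ m); apply.
by apply: lee_nneseries => [c _ _|c _]; [exact: measure_ge0|exact: PC].
Qed.

End zigzag_null.

Theorem corollary6p1 (R : realType) :
  exists N M : set (homeo R),
    [/\ haar_null R N, meagre M, N `|` M = [set: homeo R] & N `&` M = set0].
Proof.
exists (\bigcap_m @zigzag_union R m), (~` \bigcap_m @zigzag_union R m).
split; [|rewrite setC_bigcap|exact: setUv|exact: setICr].
  by exists (\bigcap_m @zigzag_union R m) => //; exact: zigzag_haar_null.
(* By De Morgan, M is a countable union of complements of dense open sets. *)
exists (fun m => ~` @zigzag_union R m) => // m.
apply: nowhere_dense_setC; last exact: zigzag_union_dense.
by apply: bigcup_open => c _; exact: zigzag_box_open.
Qed.
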